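(* Let $K(x) = \frac12 e^{-|x|}$. Any weak traveling wave solution $(x,t) \mapsto u(x,t) = v(x - ct)$ (with $c \in \mathbb{R}$ and $v : \mathbb{R} \to \mathbb{R}$) of the Cauchy problem $$ u_t + u u_x + K * u_x = 0, \qquad u|_{t=0} = v $$ (convolution in the $x$ variable) whose wave profile $v$ is bounded and absolutely continuous, in the sense that $v$ is differentiable almost everywhere with locally integrable derivative, is a weak entropy solution of this Cauchy problem.
   Context: $K'(x) = -\frac12 \operatorname{sgn}(x) e^{-|x|}$. Let $u_0 \in L^\infty(\mathbb{R})$ and let $u : \mathbb{R}\times[0,\infty) \to \mathbb{R}$ be measurable and bounded on $\mathbb{R}\times[0,T]$ for every $T>0$. Weak solution: $u$ is a weak solution of $u_t + uu_x + K*u_x = 0$, $u|_{t=0} = u_0$, if for every $\phi \in C_c^\infty(\mathbb{R}^2)$ $$\int_0^\infty\!\int_{-\infty}^\infty \Big( u(x,t)\,\partial_t\phi(x,t) + \frac{u(x,t)^2}{2}\,\partial_x\phi(x,t) - \big(K' * u(\cdot,t)\big)(x)\,\phi(x,t)\Big)\,dx\,dt + \int_{-\infty}^\infty u_0(x)\phi(x,0)\,dx = 0 .$$ Weak entropy solution (initial value in $L^\infty$, no integrability in $x$ required): $u$ is a weak entropy solution of the same Cauchy problem if for all $\lambda \in \mathbb{R}$ and all nonnegative $\phi \in C_c^\infty(\mathbb{R}^2)$ $$0 \leq \int_0^\infty\!\int_{-\infty}^\infty \Big( |u(x,t)-\lambda|\,\partial_t\phi(x,t) + \operatorname{sgn}(u(x,t)-\lambda)\frac{u(x,t)^2-\lambda^2}{2}\,\partial_x\phi(x,t)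 - \operatorname{sgn}(u(x,t)-\lambda)\,\big(K' * u(\cdot,t)\big)(x)\,\phi(x,t)\Big)\,dx\,dt + \int_{-\infty}^\infty |u_0(x)-\lambda|\,\phi(x,0)\,dx .$$ *)

(* Defs.v *)
From mathcomp Require Export all_boot all_order all_algebra.
From mathcomp Require Export all_classical all_reals all_analysis.
Export Order.TTheory GRing.Theory Num.Theory.
Export numFieldNormedType.Exports.

Set Implicit Arguments.
Unset Strict Implicit.
Unset Printing Implicit Defensive.

Local Open Scope classical_set_scope.
Local Open Scope ring_scope.

Section TestFunctions.
Variable R : realType.

(* Points of the plane are pairs (x, t). *)
Definition partial_x (phi : R * R -> R) : R * R -> R :=
  fun p => 'D_((1, 0) : R * R) phi p.

Definition partial_t (phi : R * R -> R) : R * R -> R :=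
  fun p => 'D_((0, 1) : R * R) phi p.

Fixpoint Cn (n : nat) (phi : R * R -> R) : Prop :=
  if n is m.+1 then
    [/\ continuous phi,
        (forall p, derivable phi p ((1, 0) : R * R)),
        (forall p, derivable phi p ((0, 1) : R * R)),
        Cn m (partial_x phi) &
        Cn m (partial_t phi)]
  else continuous phi.

Definition test_function (phi : R * R -> R) : Prop :=
  (forall n, Cn n phi) /\ compact (closure [set p | phi p != 0]).

End TestFunctions.

Section Equation.
Variable R : realType.
Let mu : measure _ R := @lebesgue_measure R.

Definition kernel_K (x : R) : R := 2^-1 * expR (- `|x|).

Definition kernel_dK (x : R) : R := - 2^-1 * Num.sg x * expR (- `|x|).

Lemma is_derive_kernel_K (x : R) :
  x != 0 -> is_derive x 1 kernel_K (kernel_dK x).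
Proof.
rewrite neq_lt => /orP[x0|x0].
- have d : is_derive x 1 (fun y : R => 2^-1 * expR y) (2^-1 * expR x).
    by apply: is_derive_eq.
  have -> : kernel_dK x = 2^-1 * expR x.
    by rewrite /kernel_dK ltr0_sg// ltr0_norm// opprK mulrN1 opprK.
  apply: near_eq_is_derive d.
  near=> y.
  have y0 : y < 0 by near: y; exact: lt_nbhsl.
  by rewrite /kernel_K ltr0_norm// opprK.
- have d : is_derive x 1 (fun y : R => 2^-1 * expR (- y)) (- 2^-1 * expR (- x)).
    by apply: is_derive_eq; rewrite /GRing.scale/= mulrN1 mulrN mulNr.
  have -> : kernel_dK x = - 2^-1 * expR (- x).
    by rewrite /kernel_dK gtr0_sg// gtr0_norm// mulr1.
  apply: near_eq_is_derive d.
  near=> y.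
  have y0 : 0 < y by near: y; exact: lt_nbhsr.
  by rewrite /kernel_K gtr0_norm.
Unshelve. all: by end_near. Qed.

Definition convolution (f g : R -> R) (x : R) : R :=
  \int[mu]_y (f (x - y) * g y).

(* Functions on the half-plane t >= 0 are represented by functions
   u : R -> R -> R of (x, t); the values u x t with t < 0 are never used. *)
Definition admissible (u0 : R -> R) (u : R -> R -> R) : Prop :=
  [/\ u0 \in Lfun mu +oo%E,
      measurable_fun ([set: R] `*` `[0 : R, +oo[%classic)
        (fun p : R * R => u p.1 p.2) &
      forall T : R, 0 < T ->
        [bounded u p.1 p.2 | p in [set: R] `*` `[0, T]%classic]].

(* Here K * u_x is read as K' * u. *)
Definition weak_solution (u0 : R -> R) (u : R -> R -> R) : Prop :=
  admissible u0 u /\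
  forall phi : R * R -> R, test_function phi ->
    \int[mu]_(t in `[0, +oo[) (\int[mu]_x
       (u x t * partial_t phi (x, t)
        + u x t ^+ 2 / 2 * partial_x phi (x, t)
        - convolution kernel_dK (u ^~ t) x * phi (x, t)))
    + \int[mu]_x (u0 x * phi (x, 0)) = 0.

Definition weak_entropy_solution (u0 : R -> R) (u : R -> R -> R) : Prop :=
  admissible u0 u /\
  forall (lambda : R) (phi : R * R -> R), test_function phi ->
    (forall p, 0 <= phi p) ->
    0 <=
    \int[mu]_(t in `[0, +oo[) (\int[mu]_x
       (`|u x t - lambda| * partial_t phi (x, t)
        + Num.sg (u x t - lambda) * ((u x t ^+ 2 - lambda ^+ 2) / 2)
          * partial_x phi (x, t)
        - Num.sg (u x t - lambda) * convolution kernel_dK (u ^~ t) x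
          * phi (x, t)))
    + \int[mu]_x (`|u0 x - lambda| * phi (x, 0)).

Definition traveling_wave (c : R) (v : R -> R) : R -> R -> R :=
  fun x t => v (x - c * t).

Definition absolutely_continuous_on (a b : R) (f : R -> R) : Prop :=
  forall e : R, 0 < e -> exists2 d : R, 0 < d &
    forall (n : nat) (x y : 'I_n -> R),
      (forall i, a <= x i /\ x i <= y i /\ y i <= b) ->
      trivIset [set: 'I_n] (fun i => `]x i, y i[%classic) ->
      \sum_(i < n) (y i - x i) < d ->
      \sum_(i < n) `|f (y i) - f (x i)| < e.

(* Almost everywhere differentiability and local integrability of the
   derivative alone would admit jumps and Cantor-type functions, so absolute
   continuity on compact intervals, which implies both, is required as well. *)
Definition absolutely_continuous (f : R -> R) : Prop :=
  (forall a b : R, absolutely_continuous_on a b f) /\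
  exists f' : R -> R, locally_integrable [set: R] f' /\
    {ae mu, forall x : R, is_derive (x : R) 1 f (f' x)}.

End Equation.

(* Main.v *)
Require Import Defs.
From mathcomp Require Import measurable_realfun lra ring.

(** Put f(u) = u^2/2 - c u and G = K' * v.  In the moving frame xi = x - c t the
    weak formulation says that (f(v))' = - G in the sense of distributions.  As
    v is continuous, so is G; hence f(v) is C^1, even where v is not
    differentiable.  For fixed lambda and t, the function
    p(xi) = (f(v(xi)) - f(lambda)) phi(xi + c t, t) is C^1 and vanishes wherever
    v = lambda, so that the integral of sgn(v - lambda) p' is 0.  What is left of
    the entropy functional is the integral of |v(xi) - lambda| times the
    t-derivative of phi(xi + c t, t), which the initial term cancels: the entropy
    inequality holds with equality. *)

Local Open Scope classical_set_scope.
Local Open Scope ring_scope.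
Set Implicit Arguments.
Unset Strict Implicit.
Unset Printing Implicit Defensive.

(** The delicate step is the vanishing of the integral of sgn(v - lambda) p'. Nothing is known of
    the zero set of v - lambda beyond its being closed, so the line cannot be cut into finitely many
    intervals of constant sign. Instead, sgn(v - lambda) p is compared with a primitive of sgn(v -
    lambda) p': the difference of the two has derivative 0 at every point, zeros of v - lambda
    included, hence is constant. What brings in p is the identity sgn(v - lambda) (v^2 - lambda^2)/2
    = sgn(v - lambda) (f(v) - f(lambda)) + c |v - lambda|, whose last term completes the derivative
    of phi along the lines x - c t = const. The equation of the profile is extracted with test
    functions a(x - c t) b(t), for which the integral over x splits into a function of t times
    constants; all iterated integrals are thus computed one variable at a time, without Fubini. *)

Section Calculus.
Variable R : realType.
Implicit Types (f g F : R -> R) (a b x : R).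
Let mu : measure _ R := @lebesgue_measure R.

(** * Primitives, and integrals of compactly supported functions *)

Lemma continuous_integrable_itv f a b : continuous f ->
  mu.-integrable `[a, b] (EFin \o f).
Proof.
move=> cf; apply: continuous_compact_integrable; first exact: segment_compact.
exact: continuous_subspaceT.
Qed.

Lemma is_derive1_continuous F f : (forall x, is_derive x 1 F (f x)) ->
  continuous F.
Proof.
move=> dF x; apply/differentiable_continuous/derivable1_diffP.
by have [] := dF x.
Qed.

Lemma Rintegral_derive F f a b : a <= b ->
  (forall x, is_derive x 1 F (f x)) -> continuous f ->
  \int[mu]_(x in `[a, b]) f x = F b - F a.
Proof.
rewrite le_eqVlt => /predU1P[<-|ab] dF cf.
  by rewrite set_itv1 Rintegral_set1 subrr.
have cF := is_derive1_continuous dF.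
rewrite /Rintegral (@continuous_FTC2 _ f F)//.
- exact: continuous_subspaceT.
- split=> [x _||]; first by have [] := dF x.
  + by apply: cvg_at_right_filter; exact: cF.
  + by apply: cvg_at_left_filter; exact: cF.
- by move=> x _; rewrite derive1E; have [_ ->] := dF x.
Qed.

(** The two extensions of [f] by zero coincide pointwise. With [A] empty, this gives the vanishing
    of the integral of a function that is zero on [B]. *)
Lemma Rintegral_subset (A B : set R) f : A `<=` B ->
  (forall x, B x -> ~ A x -> f x = 0) ->
  \int[mu]_(x in B) f x = \int[mu]_(x in A) f x.
Proof.
move=> AB f0; rewrite Rintegral_mkcond [RHS]Rintegral_mkcond.
congr Rintegral; apply/funext => x; rewrite !patchE.
have [/set_mem Ax|/negP xA] := boolP (x \in A).
  by rewrite mem_set//; exact: AB.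
case: ifPn => // /set_mem Bx; apply: f0 => // Ax; apply: xA.
exact: mem_set.
Qed.

Lemma integrable_compact_support f (N : R) : continuous f ->
  (forall x, N < `|x| -> f x = 0) -> mu.-integrable setT (EFin \o f).
Proof.
move=> cf f0; have := continuous_integrable_itv (- N) N cf.
rewrite integrable_mkcond//; apply: eq_integrable => // x _.
rewrite /= patchE; case: ifPn => //= /negP xN; rewrite f0// ltNge.
by apply/negP => xn; apply: xN; rewrite inE/= in_itv/= -ler_norml.
Qed.

Lemma derive_eq0_outside F f (N : R) :
  (forall x, is_derive x 1 F (f x)) ->
  (forall x, N < `|x| -> F x = 0) -> forall x, N < `|x| -> f x = 0.
Proof.
move=> dF F0 x Nx; have [_ <-] := dF x; rewrite -[RHS](@derive_cst _ _ R (0:R) x 1).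
apply: near_eq_derive.
have : \forall y \near x, N < `|y|.
  have : `|y| @[y --> x] --> `|x| by exact: norm_continuous.
  by move/cvgr_gt; exact.
by apply: filterS => y /F0.
Qed.

Lemma Rintegral_derive_compact_support F f (N : R) :
  (forall x, is_derive x 1 F (f x)) -> continuous f ->
  (forall x, N < `|x| -> F x = 0) -> \int[mu]_x f x = 0.
Proof.
move=> dF cf F0.
have F0' := derive_eq0_outside dF F0.
pose M := `|N| + 1.
have M0 : 0 < M by rewrite ltr_wpDl.
have NM : N < M by rewrite (le_lt_trans (ler_norm N))// ltrDl.
rewrite (@Rintegral_subset `[(- M), M] setT)//; last first.
  move=> x _; rewrite /= in_itv/= -ler_norml => /negP; rewrite -ltNge => Mx.
  exact/F0'/(lt_trans NM).
rewrite (Rintegral_derive _ dF)// ?F0 ?subrr//.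
- by rewrite normrN gtr0_norm.
- by rewrite gtr0_norm.
- by rewrite ge0_cp// ltW.
Qed.

(** At least one of the two intervals in the witness is empty, so the difference is the signed
    integral from 0 to [x]. Near [x] it differs by a constant from the integral based at [- M], to
    which the fundamental theorem applies; [M] is chosen so that [- M] lies to the left of both 0
    and [x]. *)
Lemma continuous_primitive f : continuous f ->
  exists F, forall x, is_derive x 1 F (f x).
Proof.
move=> cf.
exists (fun x => \int[mu]_(t in `]0, x]) f t - \int[mu]_(t in `]x, 0]) f t) => x.
pose M := `|x| + 1.
have Mx y : `|y| <= `|x| -> - M < y < M.
  by move=> yx; rewrite -ltr_norml (le_lt_trans yx)// ltrDl.
have fi := continuous_integrable_itv (- M) M cf.
have M0 : - M < 0 < M by apply: Mx; rewrite normr0.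
have Mxx : - M < x < M by exact: Mx.
have [M0l M0r] := andP M0; have [Mxl Mxr] := andP Mxx.
have [dI DI] := @continuous_FTC1_closed _ f (- M) x M Mxr fi Mxl (cf x).
have dG : is_derive x 1
    (fun y => \int[mu]_(t in `[(- M), y]) f t - \int[mu]_(t in `[(- M), 0]) f t)
    (f x).
  rewrite -[f x]subr0; apply: is_deriveB; apply: DeriveDef => //.
  by rewrite -derive1E.
have xM : x \in `](- M), M[ by rewrite in_itv.
apply: near_eq_is_derive dG; near=> y; apply/esym.
have /andP[My yM] : - M < y < M.
  near: y; apply: filterS (near_in_itvoo xM) => y.
  by rewrite in_itv.
have [y0|y0] := leP 0 y.
  rewrite [X in _ - Rintegral _ X _]set_itv_ge ?bnd_simp -?leNgt//.
  rewrite Rintegral_set0 subr0.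
  rewrite (Rintegral_itvB (a := BLeft (- M)) (b := BRight y) (x := 0))//.
  - exact: continuous_integrable_itv.
  - by rewrite bnd_simp ltW.
rewrite [X in Rintegral _ X _ - _]set_itv_ge ?bnd_simp -?leNgt ?ltW//.
rewrite Rintegral_set0 sub0r.
rewrite -(Rintegral_itvB (a := BLeft (- M)) (b := BRight 0) (x := y)) ?opprB//.
- exact: continuous_integrable_itv.
- by rewrite bnd_simp ltW.
- by rewrite bnd_simp ltW.
Unshelve. all: by end_near. Qed.

End Calculus.

(** * The integral of a sign times a derivative *)

Section SignIntegral.
Variable R : realType.
Implicit Types (f g F : R -> R) (a b x : R).
Let mu : measure _ R := @lebesgue_measure R.

Lemma is_derive1_0 F x :
  (forall e, 0 < e -> \forall y \near x, `|F y - F x| <= e * `|y - x|) ->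
  is_derive x 1 F 0.
Proof.
move=> Fe.
have dF : h^-1 *: (F (h *: 1 + x) - F x) @[h --> (0:R)^'] --> (0 : R).
  apply/cvgr0Pnorm_le => e /Fe/nbhs_ballP[d /= d0 xd].
  exists d => //= h /=; rewrite sub0r normrN => hd h0.
  have := xd (h *: 1 + x); rewrite /ball/= opprD addrC subrK [h *: 1]mulr1.
  rewrite normrN => /(_ hd); rewrite addrK normrM normfV => He.
  by rewrite ler_pdivrMl ?normr_gt0// mulrC.
by apply: DeriveDef; [apply/cvg_ex; exists 0|apply/cvg_lim].
Qed.

Lemma sgr_itv_constant (w : R -> R) a b : a <= b -> continuous w ->
  (forall x, a <= x <= b -> w x != 0) -> Num.sg (w a) = Num.sg (w b).
Proof.
move=> ab cw w0; apply: contrapT => wab.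
have wa0 : w a != 0 by rewrite w0// lexx.
have wb0 : w b != 0 by rewrite w0// lexx andbT.
have [|x /[!in_itv]/= xab /eqP] := @IVT _ w a b 0 ab (continuous_subspaceT cw).
  rewrite minEle maxEle; move: wa0 wb0; rewrite !neq_lt.
  case/orP => wa /orP[wb|wb]; move: wab;
    rewrite ?(ltr0_sg wa) ?(gtr0_sg wa) ?(ltr0_sg wb) ?(gtr0_sg wb)// => _.
  - by rewrite (_ : w a <= w b = true) ?ltW// (lt_trans wa).
  - by rewrite [w a <= w b]leNgt (lt_trans wb wa)/= !ltW.
by rewrite (negbTE (w0 _ xab)).
Qed.

Lemma measurable_sgr : measurable_fun [set: R] (@Num.sg R).
Proof.
apply: nondecreasing_measurable => // x y.
by case: sgrP => [x0|x0|x0]; case: sgrP => // y0 xy; lra.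
Qed.

Lemma integrable_sgrM (w f : R -> R) : continuous w ->
  mu.-integrable setT (EFin \o f) ->
  mu.-integrable setT (EFin \o (fun x => Num.sg (w x) * f x)).
Proof.
move=> cw intf; apply: le_integrable (intf) => //.
  apply/measurable_EFinP; apply: measurable_funM.
    apply: measurableT_comp; first exact: measurable_sgr.
    exact: continuous_measurable_fun.
  by apply/measurable_EFinP; exact: measurable_int intf.
by move=> x _ /=; rewrite lee_fin normrM ler_piMl// normr_sg; case: (w x != 0).
Qed.

Section sign.
Variables (w p p' : R -> R) (N : R).
Hypotheses (cw : continuous w) (dp : forall x, is_derive x 1 p (p' x)).
Hypotheses (cp' : continuous p') (wp : forall x, w x = 0 -> p x = 0).
Hypothesis p0 : forall x, N < `|x| -> p x = 0.

Let g x := Num.sg (w x) * p' x.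

Let ig : mu.-integrable setT (EFin \o g).
Proof.
apply: integrable_sgrM => //.
exact: integrable_compact_support cp' (derive_eq0_outside dp p0).
Qed.

Let igs (A : set R) : measurable A -> mu.-integrable A (EFin \o g).
Proof. by move=> mA; apply: integrableS ig. Qed.

(** The sign of [w] is constant inside the interval. At an endpoint it may drop to 0, but there [p]
    vanishes too, so [sgn (w x) * p x] agrees with [sgn (w m) * p x] up to the endpoints. *)
Let int_itv a b : a < b -> (forall x, a < x < b -> w x != 0) ->
  \int[mu]_(x in `]a, b]) g x = Num.sg (w b) * p b - Num.sg (w a) * p a.
Proof.
move=> ab w0; set m := (a + b) / 2.
have am : a < m by rewrite /m; lra.
have mb : m < b by rewrite /m; lra.
have sE x : a <= x <= b -> w x != 0 -> Num.sg (w x) = Num.sg (w m).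
  move=> /andP[ax xb] wx0; have [xm|mx] := leP x m.
    apply: sgr_itv_constant => // y /andP[xy ym].
    have [<-//|xny] := eqVneq x y; apply: w0.
    by rewrite (le_lt_trans ym mb) andbT (le_lt_trans ax)// lt_neqAle xny.
  apply/esym; apply: sgr_itv_constant => //; first exact: ltW.
  move=> y /andP[my yx]; have [->//|xny] := eqVneq y x; apply: w0.
  by rewrite (lt_le_trans am my)/= (lt_le_trans _ xb)// lt_neqAle xny.
have spE x : a <= x <= b -> Num.sg (w x) * p x = Num.sg (w m) * p x.
  by move=> /sE; have [/wp ->|_ -> //] := eqVneq (w x) 0; rewrite !mulr0.
rewrite !spE ?lexx ?(ltW ab)// -mulrBr -(Rintegral_derive (ltW ab) dp)//.
rewrite -RintegralZl//; last exact: continuous_integrable_itv.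
have ii : mu.-integrable `[a, b] (EFin \o (fun x => Num.sg (w m) * p' x)).
  apply: continuous_integrable_itv => x; apply: cvgM; last exact: cp'.
  exact: cvg_cst.
(* The integrands need only agree on the open interval, since [sgn (w x)] may be 0 at [a] or [b];
   all endpoints are removed as null sets. *)
rewrite -Rintegral_itv_bndo_bndc; last exact: igs.
rewrite -[RHS]Rintegral_itv_bndo_bndc; last first.
  by apply: integrableS ii => //; apply: subset_itvl; rewrite bnd_simp.
rewrite -[RHS]Rintegral_itv_obnd_cbnd; last first.
  by apply: integrableS ii => //; exact: subset_itv_oo_cc.
apply: eq_Rintegral => x /[!inE]/= /[!in_itv]/= /andP[ax xb].
by rewrite /g sE ?ltW ?w0 ?ax.
Qed.

(** If [sgn (w x) * p x] is a primitive of [g], then [D] is constant; this is what has to be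
    shown. *)
Let D x := Num.sg (w x) * p x - \int[mu]_(t in `]-oo, x]) g t.

Let DB a b : a < b -> D b - D a =
  Num.sg (w b) * p b - Num.sg (w a) * p a - \int[mu]_(x in `]a, b]) g x.
Proof.
move=> ab; rewrite -(Rintegral_itvB (a := -oo%O) (b := BRight b) (x := a))//.
  by rewrite /D; lra.
  exact: igs.
by rewrite bnd_simp ltW.
Qed.

(** As [p x = 0], the mean value theorem bounds the boundary terms by [K * (b - x)] and
    [K * (x - a)], which add up to [K * (b - a)]; the integral of [g] contributes the second
    [K * (b - a)]. *)
Let D_bound K a b x : a < b -> a <= x <= b -> w x = 0 ->
  (forall y, a <= y <= b -> `|p' y| <= K) -> `|D b - D a| <= 2 * K * (b - a).
Proof.
move=> ab /andP[ax xb] wx0 pK; rewrite DB//.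
have K0 : 0 <= K by apply: le_trans (pK a _) => //; rewrite lexx ltW.
have sg1 (y : R) : `|Num.sg y| <= 1 by rewrite normr_sg; case: (y != 0).
have pxy y z : a <= y -> y <= z -> z <= b -> `|p z - p y| <= K * (z - y).
  move=> ay yz zb.
  have cp := is_derive1_continuous dp.
  have [c] := MVT_segment yz (fun x _ => dp x) (continuous_subspaceT cp).
  rewrite in_itv/= => /andP[yc cz] ->.
  rewrite normrM (ger0_norm (_ : 0 <= z - y)) ?subr_ge0//.
  by rewrite ler_wpM2r ?subr_ge0// pK// (le_trans ay yc)/= (le_trans cz).
have px0 := wp wx0.
have := pxy _ _ ax xb (lexx b); rewrite px0 subr0 => pb.
have := pxy _ _ (lexx a) ax xb; rewrite px0 sub0r normrN => pa.
have sp y : `|Num.sg (w y) * p y| <= `|p y| by rewrite normrM ler_piMl.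
have : `|\int[mu]_(x in `]a, b]) g x| <= K * (b - a).
  apply: le_trans (le_normr_Rintegral _ (igs _)) _ => //.
  have -> : K * (b - a) = \int[mu]_(x in `]a, b]) K.
    by rewrite Rintegral_cst//= lebesgue_measure_itv/= lte_fin ab.
  apply: le_Rintegral => //.
  - by apply: integrable_norm; exact: igs.
  - have ci : continuous (fun _ : R => K) by move=> ?; exact: cvg_cst.
    apply: integrableS (continuous_integrable_itv a b ci) => //.
    by apply: subset_itvr; rewrite bnd_simp.
  - move=> y /=; rewrite in_itv/= => /andP[ay yb].
    by rewrite normrM; apply: le_trans (pK y _); rewrite ?ler_piMl// ltW.
have := sp a; have := sp b.
move: (Num.sg (w a) * p a) (Num.sg (w b) * p b) (\int[mu]_(x in _) _) => A B I.
rewrite !ler_norml; lra.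
Qed.

(* The primitive [D] also has derivative 0 at a zero [x] of [w]: either [w] has
   no zero on some punctured neighbourhood of [x], on each side of which its sign
   is then constant, or by Rolle [p'] vanishes arbitrarily close to [x], so that
   [p' x = 0] and both terms of [D] vary by [o(y - x)]. *)
Let dD x : is_derive x 1 D 0.
Proof.
apply: is_derive1_0 => e e0.
(* Rolle will give [|p' x| <= e / 4], and the oscillation of [p'] costs another [e / 4]; so
   [K = e / 2] in [D_bound], whose factor 2 restores [e]. *)
have e40 : 0 < e / 4 by rewrite divr_gt0.
have : \forall y \near x, `|p' x - p' y| < e / 4 /\ (w x != 0 -> w y != 0).
  apply: filterI; first by have /cvgrPdist_lt/(_ _ e40) := @cp' x.
  have [wx0|/eqP wx0] := pselect (w x = 0).
    by near=> y; rewrite wx0 eqxx.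
  have /cvgr_neq0/(_ wx0) := @cw x.
  by apply: filterS.
move/nbhs_ballP => [r /= r0 xr].
have H a b : `|x - a| < r -> `|x - b| < r -> a < b -> x = a \/ x = b ->
    `|D b - D a| <= e * (b - a).
  move=> xar xbr ab xab.
  have /andP[ax xb] : a <= x <= b.
    by case: xab => ->; rewrite lexx ltW.
  have xy y : a <= y <= b -> ball x r y.
    by move=> /andP[ay yb]; move: xar xbr; rewrite /ball/= !ltr_norml; lra.
  have [[z /andP[/andP[az zb] /eqP wz]]|w0] :=
      pselect (exists z, (a < z < b) && (w z == 0)); last first.
    rewrite DB// int_itv ?subrr ?normr0 ?mulr_ge0 ?subr_ge0 ?ltW// => z azb.
    by apply/negP => wz; apply: w0; exists z; rewrite azb.
  (* The radius [r] was taken so small that [w x != 0] would exclude the zero [z]. *)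
  have wx : w x = 0.
    apply: contrapT => /eqP wx; have [] := xr z; last by move=> _ /(_ wx)/eqP.
    by apply: xy; rewrite !ltW.
  have p'x : `|p' x| <= e / 4.
    have pz := wp wz; have px := wp wx.
    have cp := is_derive1_continuous dp.
    have pe y y' : a <= y -> y < y' -> y' <= b -> p y = 0 -> p y' = 0 ->
        `|p' x| <= e / 4.
      move=> ay yy' y'b py py'.
      have [c] := MVT yy' (fun x _ => dp x) (continuous_subspaceT cp).
      rewrite in_itv/= py py' subrr => /andP[yc cy'] /esym/eqP.
      rewrite mulf_eq0 subr_eq0 (gt_eqF yy') orbF => /eqP p'c.
      have [|+ _] := xr c; last by rewrite p'c subr0 => /ltW.
      by apply: xy; rewrite (le_trans ay (ltW yc)) (le_trans (ltW cy') y'b).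
    case: xab => xE.
    - by apply: (pe x z) => //; rewrite ?xE// ltW.
    - by apply: (pe z x) => //; rewrite ?xE// ltW.
  have -> : e = 2 * (e / 2) by lra.
  apply: (D_bound ab _ wx) => [|y /xy/xr[+ _]]; first by rewrite ax.
  by move: p'x; rewrite ltr_norml !ler_norml; lra.
apply/nbhs_ballP; exists r => //= y xy.
have [yx|yx|->] := ltgtP y x; last by rewrite !subrr normr0 mulr0.
- rewrite distrC (distrC y) (gtr0_norm (_ : 0 < x - y)) ?subr_gt0//.
  by apply: H => //; rewrite ?subrr ?normr0//; [right].
- rewrite (gtr0_norm (_ : 0 < y - x)) ?subr_gt0//.
  by apply: H => //; rewrite ?subrr ?normr0//; [left].
Unshelve. all: by end_near. Qed.

(** [D] takes the same value at [- M] and [M], and [p] vanishes at both. Hence the integral of [g]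
    up to [M], which is the whole integral, equals the one up to [- M], which is 0. *)
Lemma Rintegral_sgr_derive : \int[mu]_x (Num.sg (w x) * p' x) = 0.
Proof.
have p'0 := derive_eq0_outside dp p0.
pose M := `|N| + 1.
have M0 : 0 < M by rewrite ltr_wpDl.
have NM : N < M by rewrite (le_lt_trans (ler_norm N))// ltrDl.
have pM : p M = 0 by rewrite p0// gtr0_norm.
have pNM : p (- M) = 0 by rewrite p0// normrN gtr0_norm.
have := is_derive_0_is_cst (- M) M dD; rewrite /D pM pNM !mulr0 !sub0r.
move=> /oppr_inj.
rewrite (@Rintegral_subset _ set0)//; last first.
  move=> x /= + _; rewrite in_itv/= => xM; rewrite /g p'0 ?mulr0//.
  by rewrite (lt_le_trans NM)// ler_normr lerNr xM orbT.
rewrite Rintegral_set0 => ->; apply: Rintegral_subset => // x _ /=.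
rewrite in_itv/= => /negP; rewrite -ltNge => Mx; rewrite /g p'0 ?mulr0//.
by rewrite (lt_trans NM)// (lt_le_trans Mx)// ler_norm.
Qed.

End sign.
End SignIntegral.

(** * Smooth compactly supported functions *)

Section Bump.
Variable R : realType.
Implicit Types (f g F a b : R -> R) (x : R).
(** One-variable counterpart of [Cn]. Each derivative is an explicit witness, so closure under an
    operation amounts to naming the derivative of the result. *)
Fixpoint C1n (n : nat) (f : R -> R) : Prop :=
  if n is m.+1 then
    exists2 g, (forall x, is_derive x 1 f (g x)) & C1n m g
  else continuous f.

Definition smooth f := forall n, C1n n f.

Lemma C1n_continuous n f : C1n n f -> continuous f.
Proof. by case: n => [//|n] [g df _]; exact: is_derive1_continuous df. Qed.

Lemma C1nW n f : C1n n.+1 f -> C1n n f.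
Proof.
elim: n f => [|n IHn] f [g df Cg]; first exact: is_derive1_continuous df.
by exists g => //; exact: IHn.
Qed.

Lemma C1n_cst n (k : R) : C1n n (fun=> k).
Proof.
elim: n k => [|n IHn] k /=; first by move=> x; exact: cvg_cst.
by exists (fun=> 0) => // x; exact: is_derive_cst.
Qed.

Lemma C1nD n f g : C1n n f -> C1n n g -> C1n n (fun x => f x + g x).
Proof.
elim: n f g => [|n IHn] f g /=.
  by move=> cf cg x; apply: cvgD; [exact: cf|exact: cg].
move=> [f' df Cf'] [g' dg Cg']; exists (fun x => f' x + g' x); last exact: IHn.
by move=> x; exact: is_deriveD.
Qed.

Lemma C1nM n f g : C1n n f -> C1n n g -> C1n n (fun x => f x * g x).
Proof.
elim: n f g => [|n IHn] f g /=.
  by move=> cf cg x; apply: cvgM; [exact: cf|exact: cg].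
move=> [f' df Cf'] [g' dg Cg'].
exists (fun x => f x * g' x + g x * f' x); first by move=> x; exact: is_deriveM.
by apply: C1nD; apply: IHn => //; apply: C1nW; [exists f'|exists g'].
Qed.

Lemma is_derive1_affine f (df k m x : R) : is_derive (k * x + m) 1 f df ->
  is_derive x 1 (fun y => f (k * y + m)) (df * k).
Proof.
move=> dfx; apply: (@is_derive1_comp _ f (fun y => k * y + m)).
by apply: is_derive_eq; rewrite /GRing.scale/=; lra.
Qed.

Lemma C1n_affine n f (k m : R) : C1n n f -> C1n n (fun x => f (k * x + m)).
Proof.
elim: n f => [|n IHn] f /=.
  move=> cf x; apply: (continuous_comp (f := fun x => k * x + m)); last exact: cf.
  by apply: cvgD; [apply: cvgM; [exact: cvg_cst|exact: cvg_id]|exact: cvg_cst].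
move=> [g df Cg]; exists (fun x => g (k * x + m) * k).
  by move=> x; exact: is_derive1_affine.
by apply: C1nM; [exact: IHn|exact: C1n_cst].
Qed.

(* The functions [P(1/x) exp(-1/x)], extended by 0 to [x <= 0], form a family
   closed under derivation. *)
Definition exp_flat (P : {poly R}) (x : R) : R :=
  if 0 < x then P.[x^-1] * expR (- x^-1) else 0.

(** The restriction to [1 <= y] lets each constant coefficient be absorbed by a power of [y]. The
    bound is used at [y = x^-1] with [0 < x < 1]. *)
Lemma horner_le_expn (P : {poly R}) :
  exists C, exists n, forall y, 1 <= y -> `|P.[y]| <= C * y ^+ n.
Proof.
elim/poly_ind: P => [|P k [C [n Pn]]].
  by exists 0, 0%N => y y1; rewrite horner0 normr0 mul0r.
exists (C + `|k|), n.+1 => y y1; have y0 : 0 <= y by rewrite (le_trans _ y1).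
rewrite !hornerE mulrDl.
apply: le_trans (ler_normD _ _) _; apply: lerD.
  by rewrite normrM exprSr mulrA (ger0_norm y0) ler_wpM2r// Pn.
by rewrite ler_peMr// exprn_ege1.
Qed.

Lemma exp_flat_le_sqr (P : {poly R}) :
  exists2 C, 0 < C & forall x, `|x| < 1 -> `|exp_flat P x| <= C * x ^+ 2.
Proof.
have [C [n Pn]] := horner_le_expn P.
have C0 : 0 <= C by have := Pn 1 (lexx _); rewrite expr1n mulr1; exact: le_trans.
(* From [y^(n+2) / (n+2)! <= exp y] follows [y^n exp(-y) <= (n+2)! y^(-2) = K x^2]. *)
pose K : R := (n.+2)`!%:R.
have K0 : 0 < K by rewrite ltr0n fact_gt0.
(* The summand 1 keeps the constant positive when [C = 0]. *)
exists (C * K + 1) => [|x x1]; first by rewrite ltr_wpDl// mulr_ge0// ltW.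
rewrite /exp_flat; case: ifPn => [x0|_]; last first.
  by rewrite normr0 mulr_ge0 ?sqr_ge0// addr_ge0// mulr_ge0// ltW.
set y := x^-1; have y0 : 0 < y by rewrite invr_gt0.
have y1 : 1 <= y by rewrite invf_ge1// ltW// (le_lt_trans (ler_norm x)).
rewrite normrM (gtr0_norm (expR_gt0 _)) expRN.
have yE : y ^+ n * x ^- 2 / K <= expR y.
  rewrite -exprVn -/y -exprD addn2.
  by apply: le_trans (expR_ge1Dxn n.+1 (ltW y0)); rewrite lerDr.
rewrite ler_pdivrMr ?expR_gt0//.
apply: le_trans (Pn _ y1) _.
apply: (@le_trans _ _ ((C * K) * x ^+ 2 * expR y)); last first.
  by rewrite ler_wpM2r ?expR_ge0// ler_wpM2r ?sqr_ge0// lerDl.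
have -> : C * y ^+ n = C * K * x ^+ 2 * (y ^+ n * x ^- 2 / K).
  by field; rewrite !gt_eqF.
by rewrite ler_wpM2l// mulr_ge0 ?sqr_ge0// mulr_ge0// ltW.
Qed.

(** For [x > 0] and [y = 1/x], the derivative of [P(y) exp(-y)] in [y] is [(P' - P)(y) exp(-y)], and
    that of [y] in [x] is [- y^2]. At 0 the quadratic bound sends the difference quotient to 0. *)
Lemma is_derive_exp_flat (P : {poly R}) x :
  is_derive x 1 (exp_flat P) (exp_flat ('X^2 * (P - P^`())) x).
Proof.
have [x0|x0|->] := ltgtP x 0.
- have E0 Q y : y < 0 -> exp_flat Q y = 0 by move=> y0; rewrite /exp_flat lt_gtF.
  rewrite E0//; apply: near_eq_is_derive (is_derive_cst 0 x 1).
  by near=> y; rewrite E0//; near: y; exact: lt_nbhsl.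
- have xn0 : x != 0 by rewrite gt_eqF.
  rewrite {2}/exp_flat x0.
  have dE : is_derive x^-1 1 (fun y => P.[y] * expR (- y))
      ((P^`().[x^-1] - P.[x^-1]) * expR (- x^-1)).
    by apply: is_derive_eq; rewrite /GRing.scale/=; lra.
  have dV : is_derive x 1 (fun y : R => y^-1) (- x ^- 2 *: 1).
    exact: (is_deriveV (f := id)).
  have := is_derive1_comp dE dV.
  have -> : ('X^2 * (P - P^`())).[x^-1] * expR (- x^-1) =
      (P^`().[x^-1] - P.[x^-1]) * expR (- x^-1) * (- x ^- 2 *: 1).
    by rewrite !hornerE -exprVn /GRing.scale/=; ring.
  apply: near_eq_is_derive; near=> y => /=.
  rewrite /exp_flat ifT//; near: y; exact: lt_nbhsr.
- rewrite {2}/exp_flat ltxx; apply: is_derive1_0 => e e0.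
  have [C C0 PC] := exp_flat_le_sqr P.
  have near0 d : 0 < d -> \forall y \near (0 : R), `|y| < d.
    by move=> d0; exact: (@nbhs0_lt R R d d0).
  near=> y; rewrite [X in _ - X]/exp_flat ltxx !subr0.
  have y1 : `|y| < 1.
    by near: y; exact: near0.
  apply: le_trans (PC _ y1) _; rewrite -real_normK ?num_real// expr2 mulrA ler_wpM2r//.
  rewrite -ler_pdivlMl//; apply/ltW.
  near: y; by apply: near0; rewrite mulr_gt0// invr_gt0.
Unshelve. all: by end_near. Qed.

Lemma smooth_exp_flat (P : {poly R}) : smooth (exp_flat P).
Proof.
move=> n; elim: n P => [|n IHn] P.
  exact: is_derive1_continuous (is_derive_exp_flat P).
by exists (exp_flat ('X^2 * (P - P^`()))); [exact: is_derive_exp_flat|exact: IHn].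
Qed.

(** The support is [[0, 1]] rather than a symmetric interval: used as a function of time, [bump]
    then lives in [t >= 0] and vanishes at the initial time. The form [-1 * x + 1] suits
    [C1n_affine]. *)
Definition bump x := exp_flat 1 x * exp_flat 1 (-1 * x + 1).

Lemma smooth_bump : smooth bump.
Proof.
by move=> n; apply: C1nM; [|apply: C1n_affine]; exact: smooth_exp_flat.
Qed.

Lemma bump_ge0 x : 0 <= bump x.
Proof.
by apply: mulr_ge0; rewrite /exp_flat; case: ifP => // _; rewrite hornerE mul1r expR_ge0.
Qed.

Lemma bump_gt0 x : 0 < x < 1 -> 0 < bump x.
Proof.
move=> /andP[x0 x1]; rewrite /bump /exp_flat x0 ifT; last by lra.
by apply: mulr_gt0; rewrite hornerE mul1r expR_gt0.
Qed.

Lemma bump_eq0 x : ~~ (0 < x < 1) -> bump x = 0.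
Proof.
rewrite negb_and -!leNgt => /orP[x0|x1]; rewrite /bump /exp_flat.
  by rewrite ltNge x0 mul0r.
by rewrite [X in _ * X]ifF ?mulr0//; apply/negbTE; rewrite -leNgt; lra.
Qed.

End Bump.

(** * Invariance of the integral, and convolution with [kernel_dK] *)

Section Convolution.
Variable R : realType.
Implicit Types (f g F a b : R -> R) (x : R).
Let mu : measure _ R := @lebesgue_measure R.

(** The change of variables for nonnegative functions is applied to the positive and the negative
    part separately. *)
Lemma Rintegral_measure_preserving (T : R -> R) f :
  measurable_fun [set: R] T -> measurable_fun [set: R] f ->
  (forall A, measurable A -> mu (T @^-1` A) = mu A) ->
  \int[mu]_x f (T x) = \int[mu]_x f x.
Proof.
move=> mT mf muT.
have ge0 (h : R -> \bar R) : measurable_fun [set: R] h ->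
    (forall x, 0 <= h x)%E -> (\int[mu]_x h (T x) = \int[mu]_x h x)%E.
  move=> mh h0.
  have := @ge0_integral_pushforward _ _ (measurableTypeR R) (measurableTypeR R) R
    T mT mu setT h measurableT mh (fun x _ => h0 x).
  rewrite preimage_setT => <-.
  by apply: eq_measure_integral => //= A mA _; exact: muT.
have mEf : measurable_fun [set: R] (EFin \o f) by exact/measurable_EFinP.
congr fine; rewrite integralE [RHS]integralE; congr (_ - _)%E.
- rewrite -[RHS]ge0//; last exact: measurable_funepos.
  by apply: eq_integral => x _; rewrite !funeposE.
- rewrite -[RHS]ge0//; last exact: measurable_funeneg.
  by apply: eq_integral => x _; rewrite !funenegE.
Qed.

(** The translated measure agrees with Lebesgue measure on half-open intervals, which determine
    it. *)
Lemma Rintegral_shift f (r : R) : measurable_fun [set: R] f ->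
  \int[mu]_x f (x - r) = \int[mu]_x f x.
Proof.
move=> mf.
have mT : measurable_fun [set: R] (fun x : R => x - r) by exact: measurable_funB.
apply: (@Rintegral_measure_preserving (fun x => x - r)) => // A mA.
rewrite -[LHS]/(pushforward mu (fun x : measurableTypeR R => (x - r : measurableTypeR R)) A).
apply/esym/lebesgue_measure_unique => //= _ [[c d]] _ <-.
rewrite /pushforward (_ : _ @^-1` _ = `]c + r, d + r]%classic).
  rewrite !lebesgue_measure_itv/= !lte_fin ltrD2r.
  by congr (if _ then _ else _); congr EFin; lra.
by apply/seteqP; split => y /=; rewrite !in_itv/=; lra.
Qed.

Lemma Rintegral_reflect f (r : R) : measurable_fun [set: R] f ->
  \int[mu]_x f (r - x) = \int[mu]_x f x.
Proof.
move=> mf; rewrite -(Rintegral_shift (- r) mf).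
have mT : measurable_fun [set: R] (fun x : R => - x) by exact: measurable_funN.
rewrite -[RHS](@Rintegral_measure_preserving (fun x => - x))//.
- by congr Rintegral; apply/funext => x; congr f; lra.
- by apply: measurableT_comp => //; exact: measurable_funB.
- by move=> A mA; exact: lebesgue_measureN.
Qed.

Lemma measurable_kernel_dK : measurable_fun [set: R] (@kernel_dK R).
Proof.
apply: measurable_funM.
  by apply: measurable_funM => //; exact: measurable_sgr.
apply: measurableT_comp; first exact: measurable_expR.
by apply: measurableT_comp => //; exact: measurableT_comp.
Qed.

(** By symmetry the integral is twice that over the half-line, where the integrand is the density of
    the exponential law of rate 1. *)
Lemma integrable_expR_norm : mu.-integrable setT (EFin \o (fun x => expR (- `|x|))).
Proof.
have ce : continuous (fun x : R => expR (- `|x|)).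
  move=> x; apply: continuous_comp; last exact: continuous_expR.
  by apply: continuousN; exact: norm_continuous.
apply/integrableP; split.
  by apply/measurable_EFinP; exact: continuous_measurable_fun.
under eq_integral do rewrite /= ger0_norm ?expR_ge0//.
rewrite ge0_symfun_integralT//; last by move=> x /=; rewrite normrN.
  rewrite (_ : [set x | _] = `[0, +oo[%classic); last first.
    by apply/seteqP; split => y /=; rewrite in_itv/= andbT.
  have -> : (\int[mu]_(x in `[0%R, +oo[) (expR (- `|x|))%:E =
      \int[mu]_(x in `[0%R, +oo[) (exponential_pdf 1 x)%:E)%E.
    apply: eq_integral => x; rewrite inE/= in_itv/= andbT => x0.
    by rewrite exponential_pdfE// mul1r mulN1r ger0_norm.
  have /integrableP[_] : mu.-integrable `[0, +oo[ (EFin \o exponential_pdf (1:R)).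
    apply: integrableS (integrable_exponential_pdf ltr01) => //.
  under eq_integral do rewrite /= ger0_norm ?exponential_pdf_ge0//.
  by move=> ?; rewrite lte_mul_pinfty.
Qed.

Lemma normr_kernel_dK_le x : `|kernel_dK x| <= expR (- `|x|).
Proof.
rewrite /kernel_dK normrM (ger0_norm (expR_ge0 _)) ler_piMl ?expR_ge0//.
rewrite normrM normr_sg normrN normfV ger0_norm//.
by case: (x != 0) => /=; lra.
Qed.

(** With [r = c * t], this turns the nonlocal term of the wave at time [t] into that of the profile,
    evaluated at [x - c * t]. *)
Lemma convolution_shift f g (r x : R) :
  measurable_fun [set: R] f -> measurable_fun [set: R] g ->
  convolution f (fun y => g (y - r)) x = convolution f g (x - r).
Proof.
move=> mf mg; rewrite /convolution -[RHS](@Rintegral_shift _ r).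
  by apply: eq_Rintegral => y _; congr (f _ * _); lra.
apply: measurable_funM => //; apply: measurableT_comp => //.
exact: measurable_funB.
Qed.

(** [kernel_dK] jumps at 0, so the substitution of [x - y] for [y] first moves the dependence on [x]
    to the continuous factor [v]; dominated convergence then applies with the bound
    [M * expR (- |y|)]. *)
Lemma continuous_convolution_dK (v : R -> R) (M : R) :
  continuous v -> (forall x, `|v x| <= M) ->
  continuous (convolution (@kernel_dK R) v).
Proof.
move=> cv vM.
have mv : measurable_fun [set: R] v by exact: continuous_measurable_fun.
have mK := measurable_kernel_dK.
have mKv x : measurable_fun [set: R] (fun y => kernel_dK y * v (x - y)).
  by apply: measurable_funM => //; apply: measurableT_comp => //; exact: measurable_funB.
have -> : convolution (@kernel_dK R) v =
    fun x => \int[mu]_y (kernel_dK y * v (x - y)).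
  apply/funext => x; rewrite /convolution -[RHS](@Rintegral_reflect _ x)//.
  by apply: eq_Rintegral => y _; congr (_ * v _); lra.
move=> x.
have KM z y : `|kernel_dK y * v (z - y)| <= M * expR (- `|y|).
  by rewrite normrM mulrC ler_pM// normr_kernel_dK_le.
have ig : mu.-integrable setT (EFin \o (fun y => M * expR (- `|y|))).
  exact: integrableZl integrable_expR_norm.
apply: (@continuity_under_integral _ _ _ mu (fun x y => kernel_dK y * v (x - y))
  setT _ (x - 1) (x + 1) _ _ (fun y => M * expR (- `|y|))) => //.
- move=> z _; apply: le_integrable ig => //.
    by apply/measurable_EFinP; exact: mKv.
  by move=> y _ /=; rewrite lee_fin (le_trans (KM z y))// ler_norm.
- apply: aeW => y _ z _; apply: cvgM; first exact: cvg_cst.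
  apply: (continuous_comp (f := fun z => z - y)); last exact: cv.
  by apply: cvgB; [exact: cvg_id|exact: cvg_cst].
- by move=> z _; apply: aeW => y _; exact: KM.
- by rewrite inE/= in_itv/=; lra.
Qed.

End Convolution.

(** * Test functions on the plane *)

Section TestFunctionsOfTheWave.
Variable R : realType.
Implicit Types (f g F a b : R -> R) (x t : R) (phi psi : R * R -> R).

Lemma is_derive_fst phi (p : R * R) (d : R) :
  is_derive p ((1, 0) : R * R) phi d <->
  is_derive p.1 1 (fun y => phi (y, p.2)) d.
Proof.
have E : (fun h : R => h^-1 *: ((phi \o shift p) (h *: ((1, 0) : R * R)) - phi p)) =
  (fun h => h^-1 *: (((fun y => phi (y, p.2)) \o shift p.1) (h *: 1) - phi (p.1, p.2))).
  apply/funext => h /=; rewrite -surjective_pairing; congr (_ *: (phi _ - _)).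
  by case: p => x t /=; congr (_, _); rewrite /= /GRing.scale/= mulr0 add0r.
by split=> -[D V]; apply: DeriveDef; move: D V; rewrite /derivable /derive E.
Qed.

Lemma is_derive_snd phi (p : R * R) (d : R) :
  is_derive p ((0, 1) : R * R) phi d <->
  is_derive p.2 1 (fun y => phi (p.1, y)) d.
Proof.
have E : (fun h : R => h^-1 *: ((phi \o shift p) (h *: ((0, 1) : R * R)) - phi p)) =
  (fun h => h^-1 *: (((fun y => phi (p.1, y)) \o shift p.2) (h *: 1) - phi (p.1, p.2))).
  apply/funext => h /=; rewrite -surjective_pairing; congr (_ *: (phi _ - _)).
  by case: p => x t /=; congr (_, _); rewrite /= /GRing.scale/= mulr0 add0r.
by split=> -[D V]; apply: DeriveDef; move: D V; rewrite /derivable /derive E.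
Qed.

Lemma partial_xE phi phi' :
  (forall p, is_derive p ((1, 0) : R * R) phi (phi' p)) -> partial_x phi = phi'.
Proof. by move=> dphi; apply/funext => p; have [] := dphi p. Qed.

Lemma partial_tE phi phi' :
  (forall p, is_derive p ((0, 1) : R * R) phi (phi' p)) -> partial_t phi = phi'.
Proof. by move=> dphi; apply/funext => p; have [] := dphi p. Qed.

Lemma CnD n phi psi : Cn n phi -> Cn n psi -> Cn n (fun p => phi p + psi p).
Proof.
have cD (f g : R * R -> R) : continuous f -> continuous g ->
    continuous (fun p => f p + g p).
  by move=> cf cg p; apply: cvgD; [exact: cf|exact: cg].
elim: n phi psi => [|n IHn] phi psi /=; first exact: cD.
move=> [cf fx ft Cfx Cft] [cg gx gt Cgx Cgt]; split.
- exact: cD.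
- by move=> p; exact: derivableD.
- by move=> p; exact: derivableD.
- have -> : partial_x (fun p => phi p + psi p) =
      fun p => partial_x phi p + partial_x psi p.
    by apply: partial_xE => p; apply: is_deriveD; exact: derivableP.
  exact: IHn.
- have -> : partial_t (fun p => phi p + psi p) =
      fun p => partial_t phi p + partial_t psi p.
    by apply: partial_tE => p; apply: is_deriveD; exact: derivableP.
  exact: IHn.
Qed.

Definition wave_tensor (c : R) a b (p : R * R) := a (p.1 - c * p.2) * b p.2.

Lemma is_derive_x_wave_tensor (c : R) a a' b (p : R * R) :
  (forall x, is_derive x 1 a (a' x)) ->
  is_derive p ((1, 0) : R * R) (wave_tensor c a b) (wave_tensor c a' b p).
Proof.
move=> da; apply/is_derive_fst; rewrite /wave_tensor/=.
have := @is_derive1_affine _ a (a' (p.1 - c * p.2)) 1 (- (c * p.2)) p.1.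
rewrite mul1r mulr1 => /(_ (da _)) d.
rewrite (_ : (fun y => _) = (b p.2) \*: (fun y => a (1 * y - c * p.2))).
  by refine (is_derive_eq (is_deriveZ (b p.2) d) _); exact: mulrC.
by apply/funext => y /=; rewrite mul1r; exact: mulrC.
Qed.

Lemma is_derive_t_wave_tensor (c : R) a a' b b' (p : R * R) :
  (forall x, is_derive x 1 a (a' x)) -> (forall x, is_derive x 1 b (b' x)) ->
  is_derive p ((0, 1) : R * R) (wave_tensor c a b)
    (wave_tensor c (fun x => a' x * - c) b p + wave_tensor c a b' p).
Proof.
move=> da db; apply/is_derive_snd; rewrite /wave_tensor/=.
have := @is_derive1_affine _ a (a' (p.1 - c * p.2)) (- c) p.1 p.2.
rewrite (_ : - c * p.2 + p.1 = p.1 - c * p.2) => [|]; last by lra.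
move=> /(_ (da _)) d.
rewrite (_ : (fun y => _) = (fun y => a (- c * y + p.1)) * b).
  refine (is_derive_eq (is_deriveM d (db p.2)) _).
  rewrite /GRing.scale/= addrC; congr (_ + _); first by rewrite mulrC.
  by congr (a _ * _); lra.
by apply/funext => y; rewrite mulrfctE; congr (a _ * _); lra.
Qed.

(** The derivative in [t] of a tensor is a sum of two tensors, as [a] also depends on [t] through
    [x - c * t]; this is where [CnD] is needed. *)
Lemma Cn_wave_tensor n (c : R) a b : C1n n a -> C1n n b -> Cn n (wave_tensor c a b).
Proof.
have ct a0 b0 : continuous a0 -> continuous b0 -> continuous (wave_tensor c a0 b0).
  move=> ca cb p; apply: cvgM; apply: continuous_comp.
  - apply: cvgB; first exact: cvg_fst.
    by apply: cvgM; [exact: cvg_cst|exact: cvg_snd].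
  - exact: ca.
  - exact: cvg_snd.
  - exact: cb.
elim: n a b => [|n IHn] a b; first exact: ct.
move=> Ca Cb; have [a' da Ca'] := Ca; have [b' db Cb'] := Cb.
split.
- by apply: ct; exact: C1n_continuous (_ : C1n n.+1 _).
- by move=> p; have [] := is_derive_x_wave_tensor c b p da.
- by move=> p; have [] := is_derive_t_wave_tensor c p da db.
- have -> : partial_x (wave_tensor c a b) = wave_tensor c a' b.
    by apply: partial_xE => p; exact: is_derive_x_wave_tensor.
  by apply: IHn => //; exact: C1nW.
- have -> : partial_t (wave_tensor c a b) =
      fun p => wave_tensor c (fun x => a' x * - c) b p + wave_tensor c a b' p.
    by apply: partial_tE => p; exact: is_derive_t_wave_tensor.
  apply: CnD; apply: IHn; rewrite //; try exact: C1nW.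
  by apply: C1nM => //; exact: C1n_cst.
Qed.

Lemma test_function_wave_tensor (c N : R) a b : smooth a -> smooth b ->
  (forall x, N < `|x| -> a x = 0) -> (forall x, N < `|x| -> b x = 0) ->
  test_function (wave_tensor c a b).
Proof.
move=> sa sb a0 b0; split=> [n|]; first exact: Cn_wave_tensor.
(* On the support, [|x| <= |x - c t| + |c| |t|]. *)
pose M := N + `|c| * N.
pose K := `[(- M), M]%classic `*` `[(- N), N]%classic : set (R * R).
have cK : compact K by apply: compact_setX; exact: segment_compact.
apply: (subclosed_compact _ cK); first exact: closed_closure.
have clK : closed K by apply: compact_closed => //; exact: Rhausdorff.
have /closure_id -> := clK; apply: closure_subset => -[x t] /=.
rewrite /wave_tensor/= mulf_eq0 negb_or => /andP[ax bt].
have {}ax : `|x - c * t| <= N by rewrite leNgt; apply: contra ax => /a0 ->.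
have {}bt : `|t| <= N by rewrite leNgt; apply: contra bt => /b0 ->.
split => /=; rewrite in_itv/= -ler_norml//.
rewrite -[x](subrK (c * t)) (le_trans (ler_normD _ _))//.
by rewrite /M lerD// normrM ler_wpM2l.
Qed.

Lemma test_function_support phi : test_function phi ->
  exists N, forall x t, N < `|x| \/ N < `|t| -> phi (x, t) = 0.
Proof.
move=> [_ /compact_bounded[N [_ phiN]]]; exists (N + 1) => x t xtN.
apply: contrapT => /eqP phi0.
have NN : N < N + 1 by rewrite ltrDl.
have := phiN (N + 1) NN (x, t) (@subset_closure _ [set p | phi p != 0] _ phi0).
rewrite /= prod_normE/= ge_max => /andP[xN tN].
by case: xtN; rewrite ltNge ?xN ?tN.
Qed.

Lemma MVT_global F f (y z : R) : (forall x, is_derive x 1 F (f x)) ->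
  exists2 x, `|x - y| <= `|z - y| & F z - F y = f x * (z - y).
Proof.
move=> dF; have cF := is_derive1_continuous dF.
have [yz|zy] := leP y z.
  have [x] := MVT_segment yz (fun x _ => dF x) (continuous_subspaceT cF).
  rewrite in_itv/= => /andP[yx xz] FE; exists x => //.
  by rewrite !ger0_norm ?subr_ge0// lerD2r.
have [x] := MVT_segment (ltW zy) (fun x _ => dF x) (continuous_subspaceT cF).
rewrite in_itv/= => /andP[zx xy] FE; exists x; last by lra.
by rewrite ler0_norm ?subr_le0// ler0_norm ?subr_le0 ?(ltW zy)//; lra.
Qed.

(** A chain rule from partial derivatives, of which only [phi_x] has to be continuous. The increment
    from [x + c * t] to [x + c * s] is taken at the fixed time [s]: by the mean value theorem and
    the continuity of [phi_x], it is [c * A * (s - t)] up to the [o(s - t)] recorded by [D]. *)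
Lemma is_derive_along_line phi phi_x (c d x t : R) :
  (forall p, is_derive p ((1, 0) : R * R) phi (phi_x p)) -> continuous phi_x ->
  is_derive (x + c * t, t) ((0, 1) : R * R) phi d ->
  is_derive t 1 (fun s => phi (x + c * s, s)) (c * phi_x (x + c * t, t) + d).
Proof.
move=> dx cx /is_derive_snd/= dt; set A := phi_x _.
pose D s := phi (x + c * s, s) - phi (x + c * t, s) - c * A * (s - t).
have dD : is_derive t 1 D 0.
  apply: is_derive1_0 => e e0.
  have c0 : 0 < `|c| + 1 by rewrite ltr_wpDl.
  have ec0 : 0 < e / (`|c| + 1) by rewrite divr_gt0.
  have /nbhs_ballP[r /= r0 xr] : \forall p \near (x + c * t, t),
      `|A - phi_x p| < e / (`|c| + 1).
    by have /cvgrPdist_lt/(_ _ ec0) := cx (x + c * t, t).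
  (* The intermediate point lies within [|c| |s - t|] of [x + c * t], so this radius keeps both
     coordinates within [r]; the added 1 covers [c = 0]. *)
  have rc0 : 0 < r / (`|c| + 1) by rewrite divr_gt0.
  apply/nbhs_ballP; exists (r / (`|c| + 1)) => //= s ts.
  have ts' : `|s - t| * (`|c| + 1) < r by rewrite -ltr_pdivlMr// distrC.
  have [y yx yE] := @MVT_global (fun y => phi (y, s)) (fun y => phi_x (y, s))
    (x + c * t) (x + c * s) (fun y => (is_derive_fst phi (y, s) _).1 (dx _)).
  have yct : `|y - (x + c * t)| <= `|c| * `|s - t|.
    by rewrite (le_trans yx)// -normrM mulrBr opprD addrACA subrr add0r.
  have ballp : ball (x + c * t, t) r (y, s).
    have s0 := normr_ge0 (s - t); have c0' := normr_ge0 c.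
    have cs0 : 0 <= `|c| * `|s - t| by rewrite mulr_ge0.
    by split; rewrite /ball/= distrC; lra.
  have -> : D s - D t = c * (s - t) * (phi_x (y, s) - A).
    by rewrite /D yE; ring.
  rewrite !normrM (distrC _ A) mulrAC ler_wpM2r//.
  have := xr _ ballp; rewrite ltr_pdivlMr// mulrDr mulr1 mulrC.
  by have := normr_ge0 (A - phi_x (y, s)); lra.
have -> : (fun s => phi (x + c * s, s)) =
    D + ((fun s => phi (x + c * t, s)) + (fun s => c * A * (s - t))).
  by apply/funext => s; rewrite /D !fctE; ring.
have dl : is_derive t 1 (fun s => c * A * (s - t)) (c * A).
  by apply: is_derive_eq; rewrite /GRing.scale/=; ring.
by refine (is_derive_eq (is_deriveD dD (is_deriveD dt dl)) _); lra.
Qed.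

End TestFunctionsOfTheWave.

(** * The equation of the profile *)

Section Profile.
Variable R : realType.
Implicit Types (f g F a b : R -> R) (x t : R) (phi psi : R * R -> R).
Let mu : measure _ R := @lebesgue_measure R.

Lemma bump_eq0_outside x : 1 < `|x| -> bump x = 0.
Proof.
move=> x1; apply: bump_eq0; apply/negP => /andP[x0 x1'].
by move: x1; rewrite gtr0_norm//; lra.
Qed.

(** [theta] is a primitive of [bump]; the mass [theta 1 - theta 0] is not normalized to 1 but
    carried along as a positive factor. *)
Lemma smooth_step : exists2 theta : R -> R, smooth theta /\
    (forall x, is_derive x 1 theta (bump x)) &
  [/\ theta 0 < theta 1, forall x, x <= 0 -> theta x = theta 0 &
      forall x, 1 <= x -> theta x = theta 1].
Proof.
have cb : continuous (@bump R) by exact: C1n_continuous (smooth_bump R 0).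
have [theta dth] := continuous_primitive cb.
exists theta.
  split=> // n; apply: C1nW; exists (@bump R) => //; exact: smooth_bump.
have le_theta x y : x <= y -> theta x <= theta y.
  move=> xy; rewrite -subr_ge0 -(Rintegral_derive xy dth cb).
  by apply: Rintegral_ge0 => z _; exact: bump_ge0.
have cst_theta x y : x <= y -> (forall z, x <= z <= y -> bump z = 0) ->
    theta y = theta x.
  move=> xy b0.
  have [z] := MVT_segment xy (fun z _ => dth z)
    (continuous_subspaceT (is_derive1_continuous dth)).
  rewrite in_itv/= => /b0 ->; rewrite mul0r => /eqP.
  by rewrite subr_eq0 => /eqP.
split.
- have [z] := MVT ltr01 (fun z _ => dth z)
    (continuous_subspaceT (is_derive1_continuous dth)).
  rewrite in_itv/= subr0 mulr1 => /bump_gt0 b0 thE.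
  by rewrite -subr_gt0 thE.
- move=> x x0; apply/esym; apply: cst_theta => // z /andP[xz z0].
  by rewrite bump_eq0// ltNge z0.
- move=> x x1; apply: cst_theta => // z /andP[z1 zx].
  by apply: bump_eq0; apply/negP => /andP[_]; rewrite ltNge z1.
Qed.

Lemma smooth_derive_continuous a a' : smooth a ->
  (forall x, is_derive x 1 a (a' x)) -> continuous a'.
Proof.
move=> sa da; have [a'' da'' Ca''] := sa 1%N.
have -> : a' = a''; last exact: Ca''.
by apply/funext => x; have [_ <-] := da x; have [_ <-] := da'' x.
Qed.

(** The derivative of [theta((x - x0)/e)]: for [e > 0] it lives on [[x0, x0 + e]], to the right of
    [x0], and its mass does not depend on [e]. *)
Definition mollifier (e x0 x : R) := bump (e^-1 * x + - (e^-1 * x0)) * e^-1.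

Lemma continuous_mollifier (e x0 : R) : continuous (mollifier e x0).
Proof.
have : C1n 0 (mollifier e x0).
  by apply: C1nM; [apply: C1n_affine; exact: smooth_bump|exact: C1n_cst].
by [].
Qed.

Lemma mollifier_eq0 (e x0 x : R) : 0 < e -> ~~ (x0 <= x <= x0 + e) ->
  mollifier e x0 x = 0.
Proof.
move=> e0 xe; rewrite /mollifier bump_eq0 ?mul0r//; apply: contra xe.
rewrite -mulrBr ltr_pdivlMl// mulr0 subr_gt0 ltr_pdivrMl// mulr1 => /andP[? ?].
by apply/andP; split; lra.
Qed.

Lemma mollifier_eq0_outside (e x0 x : R) : 0 < e -> `|x0| + e < `|x| ->
  mollifier e x0 x = 0.
Proof.
move=> e0 xN; apply: mollifier_eq0 => //; apply: contraL xN => /andP[h1 h2].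
rewrite -leNgt ler_norml; have := lerNnormlW (lexx `|x0|).
by have := ler_norm x0; rewrite lerNl => *; apply/andP; split; lra.
Qed.

Lemma Rintegral_mollifier f (theta : R -> R) (x0 d : R) : continuous f -> 0 < d ->
  (forall x, is_derive x 1 theta (bump x)) ->
  \forall e \near (0:R)^'+,
   `| \int[mu]_x (f x * mollifier e x0 x) - f x0 * (theta 1 - theta 0) |
   <= d * (theta 1 - theta 0).
Proof.
move=> cf d0 dth.
have /nbhs_ballP[r /= r0 xr] : \forall y \near x0, `|f x0 - f y| < d.
  by have /cvgrPdist_lt/(_ _ d0) := cf x0.
near=> e.
have e0 : 0 < e by [].
have er : e < r by [].
have cm := @continuous_mollifier e x0.
have xe : x0 <= x0 + e by rewrite lerDl ltW.
have thE : theta 1 - theta 0 = \int[mu]_(x in `[x0, x0 + e]) mollifier e x0 x.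
  have dm x : is_derive x 1 (fun x => theta (e^-1 * x + - (e^-1 * x0)))
    (mollifier e x0 x) by exact: is_derive1_affine.
  rewrite (Rintegral_derive xe dm cm) subrr mulrDr addrAC subrr add0r.
  by rewrite mulVf// gt_eqF.
have cfm : continuous (fun x => f x * mollifier e x0 x).
  by move=> x; apply: cvgM; [exact: cf|exact: cm].
have ckm (k : R) : continuous (fun x => k * mollifier e x0 x).
  by move=> x; apply: cvgM; [exact: cvg_cst|exact: cm].
rewrite (@Rintegral_subset _ `[x0, x0 + e]%classic)//; last first.
  by move=> x _ /negP xe'; rewrite mollifier_eq0 ?mulr0.
rewrite thE -!RintegralZl//; [|exact: continuous_integrable_itv..].
rewrite -RintegralB//; [|exact: continuous_integrable_itv..].
have cB : continuous (fun x => f x * mollifier e x0 x - f x0 * mollifier e x0 x).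
  by move=> x; apply: cvgB; [exact: cfm|exact: ckm].
apply: le_trans (le_normr_Rintegral _ _) _ => //.
  exact: continuous_integrable_itv.
apply: le_Rintegral => //.
- by apply: integrable_norm; exact: continuous_integrable_itv.
- exact: continuous_integrable_itv.
- move=> x /=; rewrite in_itv/= => /andP[x0x xx0].
  have m0 : 0 <= mollifier e x0 x by rewrite mulr_ge0 ?bump_ge0// invr_ge0 ltW.
  rewrite -mulrBl normrM (ger0_norm m0) ler_wpM2r// distrC ltW//.
  by apply: xr; rewrite /ball/= distrC ger0_norm ?subr_ge0//; lra.
Unshelve. all: by end_near. Qed.

(** Two smooth steps, one at [x] and one at [y], have the same end values, so their difference has
    compact support and is an admissible [a]. Its derivative is the difference of two mollifiers,
    whence [f] has equal averages near [x] and near [y]. *)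
Lemma du_Bois_Reymond f : continuous f ->
  (forall a a' (N : R), smooth a -> (forall x, is_derive x 1 a (a' x)) ->
     (forall x, N < `|x| -> a x = 0) -> \int[mu]_x (f x * a' x) = 0) ->
  forall x y, f x = f y.
Proof.
move=> cf f0 x y; apply/eqP; apply: contrapT => /negP fxy.
have [theta [sth dth] [th01 th0 th1]] := smooth_step.
(* Two errors of a quarter of [|f x - f y|] add up to one half of it, less than the distance they
   would have to bridge. *)
have d0 : 0 < `|f x - f y| / 4 by rewrite divr_gt0// normr_gt0 subr_eq0.
near (0:R)^'+ => e.
have e0 : 0 < e by [].
have Hx : `| \int[mu]_z (f z * mollifier e x z) - f x * (theta 1 - theta 0) |
   <= `|f x - f y| / 4 * (theta 1 - theta 0).
  by near: e; exact: Rintegral_mollifier.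
have Hy : `| \int[mu]_z (f z * mollifier e y z) - f y * (theta 1 - theta 0) |
   <= `|f x - f y| / 4 * (theta 1 - theta 0).
  by near: e; exact: Rintegral_mollifier.
pose T (x0 z : R) : R := theta (e^-1 * z + - (e^-1 * x0)).
have dT x0 (z : R) : is_derive z 1 (T x0) (mollifier e x0 z) by exact: is_derive1_affine.
have sT x0 : smooth (T x0) by move=> n; exact: C1n_affine.
pose N := `|x| + `|y| + e.
have im x0 : mu.-integrable setT (EFin \o (fun z => f z * mollifier e x0 z)).
  apply: (@integrable_compact_support _ _ (`|x0| + e)) => [z|z zN].
    by apply: cvgM; [exact: cf|exact: continuous_mollifier].
  by rewrite mollifier_eq0_outside// mulr0.
have := f0 (fun z => T x z + -1 * T y z)
  (fun z => mollifier e x z + -1 * mollifier e y z) N.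
have -> : \int[mu]_z (f z * (mollifier e x z + -1 * mollifier e y z)) =
   \int[mu]_z (f z * mollifier e x z) - \int[mu]_z (f z * mollifier e y z).
  by rewrite -RintegralB//; apply: eq_Rintegral => z _; ring.
have T0 x0 z : z <= x0 -> T x0 z = theta 0.
  by move=> zx0; rewrite /T th0// -mulrBr ler_pdivrMl// mulr0 subr_le0.
have T1 x0 z : x0 + e <= z -> T x0 z = theta 1.
  by move=> zx0; rewrite /T th1// -mulrBr ler_pdivlMl// mulr1; lra.
move=> H.
have E : \int[mu]_z (f z * mollifier e x z) = \int[mu]_z (f z * mollifier e y z).
  apply/eqP; rewrite -subr_eq0; apply/eqP; apply: H.
  - move=> n; apply: C1nD; first exact: sT.
    by apply: C1nM; [exact: C1n_cst|exact: sT].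
  - move=> z; rewrite /N ltr_normr => zN.
    have [] := (ler_norm x, ler_norm y).
    have [] := (lerNnormlW (lexx `|x|), lerNnormlW (lexx `|y|)).
    have [] := (normr_ge0 x, normr_ge0 y); move=> *.
    case/orP: zN => zN; first by rewrite !T1; lra.
    by rewrite !T0; lra.
move: Hx Hy; rewrite -E; set I := Rintegral _ _ _; set th := theta 1 - theta 0.
have th_gt0 : 0 < th by rewrite subr_gt0.
move=> Hx Hy.
have : `|f x - f y| * th <= `|f x - f y| / 2 * th.
  rewrite -[X in _ * X <= _](gtr0_norm th_gt0) -normrM mulrBl.
  move: Hx Hy; rewrite !ler_norml => /andP[? ?] /andP[? ?].
  apply/andP; split; lra.
rewrite ler_pM2r//; lra.
Unshelve. all: by end_near. Qed.

Section profile.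
Variables (c M : R) (v : R -> R).
Hypotheses (cv : continuous v) (vM : forall x, `|v x| <= M).
Hypothesis weak : weak_solution v (traveling_wave c v).

Let G := convolution (@kernel_dK R) v.
Let cG : continuous G. Proof. exact: continuous_convolution_dK. Qed.

Definition flux (c u : R) : R := u ^+ 2 / 2 - c * u.

Let cF : continuous (fun x => flux c (v x)).
Proof.
move=> x; apply: cvgB; last by apply: cvgM; [exact: cvg_cst|exact: cv].
by apply: cvgM; [rewrite expr2; apply: cvgM; exact: cv|exact: cvg_cst].
Qed.

(** Tested with [a(x - c t) bump(t)], the initial term drops out as [bump 0 = 0], and the integral
    over [x] is [b' t * A + bump t * B]. Over [[0, 1]] the first term integrates to 0 and the second
    to [(theta 1 - theta 0) * B], so that [B = 0]. *)
Lemma weak_profile_eq a a' (N : R) : smooth a ->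
  (forall x, is_derive x 1 a (a' x)) -> (forall x, N < `|x| -> a x = 0) ->
  \int[mu]_x (flux c (v x) * a' x - G x * a x) = 0.
Proof.
move=> sa da a0.
have ca' := smooth_derive_continuous sa da.
have ca := is_derive1_continuous da.
have a'0 := derive_eq0_outside da a0.
have [b' db cb'] := smooth_bump R 1.
have cb := is_derive1_continuous db.
have [theta [_ dtheta] [theta01 _ _]] := smooth_step.
set B := Rintegral _ _ _.
pose A := \int[mu]_x (v x * a x).
have iA : mu.-integrable setT (EFin \o (fun x => v x * a x)).
  apply: (@integrable_compact_support _ _ N) => [x|x /a0 ->]; last by rewrite mulr0.
  by apply: cvgM; [exact: cv|exact: ca].
have iB : mu.-integrable setT (EFin \o (fun x => flux c (v x) * a' x - G x * a x)).
  apply: (@integrable_compact_support _ _ N) => [x|x xN].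
    by apply: cvgB; apply: cvgM; [exact: cF|exact: ca'|exact: cG|exact: ca].
  by rewrite a'0// a0// !mulr0 subrr.
have tphi : test_function (wave_tensor c a (@bump R)).
  apply: (@test_function_wave_tensor _ c (`|N| + 1)) => //; first exact: smooth_bump.
    move=> x Nx; apply: a0; apply: le_lt_trans Nx.
    by rewrite (le_trans (ler_norm N))// lerDl.
  by move=> x Nx; apply: bump_eq0_outside; rewrite (le_lt_trans _ Nx)// lerDr.
have [_ /(_ _ tphi)] := weak.
have -> : partial_t (wave_tensor c a (@bump R)) = fun p =>
    wave_tensor c (fun x => a' x * - c) (@bump R) p + wave_tensor c a b' p.
  by apply: partial_tE => p; exact: is_derive_t_wave_tensor.
have -> : partial_x (wave_tensor c a (@bump R)) = wave_tensor c a' (@bump R).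
  by apply: partial_xE => p; exact: is_derive_x_wave_tensor.
have bump0 : bump (0 : R) = 0 by rewrite bump_eq0// ltxx.
have bump1 : bump (1 : R) = 0 by rewrite bump_eq0// ltxx andbF.
rewrite [X in _ + X](_ : _ = 0) ?addr0; last first.
  rewrite (@Rintegral_subset _ set0 setT) ?Rintegral_set0// => x _ _.
  by rewrite /wave_tensor/= bump0 !mulr0.
have inner t : \int[mu]_x (traveling_wave c v x t *
      (wave_tensor c (fun x => a' x * - c) (@bump R) (x, t) + wave_tensor c a b' (x, t))
    + traveling_wave c v x t ^+ 2 / 2 * wave_tensor c a' (@bump R) (x, t)
    - convolution (@kernel_dK R) (traveling_wave c v ^~ t) x *
      wave_tensor c a (@bump R) (x, t)) = b' t * A + bump t * B.
  rewrite /A /B -!RintegralZl// -RintegralD//; last 2 first.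
    exact: (integrableZl _ _ iA).
    exact: (integrableZl _ _ iB).
  rewrite -[RHS](@Rintegral_shift _ _ (c * t)); last first.
    apply: continuous_measurable_fun => x; apply: cvgD; apply: cvgM.
    - exact: cvg_cst.
    - by apply: cvgM; [exact: cv|exact: ca].
    - exact: cvg_cst.
    - by apply: cvgB; apply: cvgM; [exact: cF|exact: ca'|exact: cG|exact: ca].
  apply: eq_Rintegral => x _; rewrite /traveling_wave convolution_shift.
  - by rewrite /wave_tensor/= /flux -/(G _); lra.
  - exact: measurable_kernel_dK.
  - exact: continuous_measurable_fun.
under eq_Rintegral do rewrite inner.
rewrite (@Rintegral_subset _ `[0, 1]%classic); last 2 first.
- by apply: subset_itvl; rewrite bnd_simp.
- move=> t /=; rewrite !in_itv/= andbT => t0; rewrite t0/= => /negP; rewrite -ltNge => t1.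
  have t1' : 1 < `|t| by rewrite gtr0_norm// (lt_trans ltr01).
  by rewrite bump_eq0_outside// (derive_eq0_outside db bump_eq0_outside)// !mul0r addr0.
have dJ t : is_derive t 1 (fun t => bump t * A + theta t * B) (b' t * A + bump t * B).
  have := db t; have := dtheta t => *.
  by apply: is_derive_eq; rewrite /GRing.scale/=; ring.
have cJ : continuous (fun t => b' t * A + bump t * B).
  by move=> x; apply: cvgD; apply: cvgM;
    [exact: cb'|exact: cvg_cst|exact: cb|exact: cvg_cst].
rewrite (Rintegral_derive ler01 dJ cJ) bump0 bump1 !mul0r !add0r -mulrBl => /eqP.
by rewrite mulf_eq0 subr_eq0 gt_eqF// => /eqP.
Qed.

(** With [Gam] a primitive of [G], the integral of [(Gam a)' = Gam a' + G a] is 0. Added to the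
    profile equation, it cancels [G] and leaves [flux + Gam] orthogonal to every [a'], hence
    constant. *)
Lemma is_derive_flux x : is_derive x 1 (fun y => flux c (v y)) (- G x).
Proof.
have [Gam dGam] := continuous_primitive cG.
have cGam := is_derive1_continuous dGam.
have H : forall x y, flux c (v x) + Gam x = flux c (v y) + Gam y.
  apply: (@du_Bois_Reymond (fun x => flux c (v x) + Gam x)).
    by move=> y; apply: cvgD; [exact: cF|exact: cGam].
  move=> a a' N sa da a0.
  have ca' := smooth_derive_continuous sa da.
  have ca := is_derive1_continuous da.
  have a'0 := derive_eq0_outside da a0.
  have dGa (y : R) : is_derive y 1 (Gam * a) (Gam y * a' y + a y * G y) by exact: is_deriveM.
  have : \int[mu]_y (Gam y * a' y + a y * G y) = 0.
    apply: (Rintegral_derive_compact_support dGa (N := N)).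
      by move=> y; apply: cvgD; apply: cvgM;
        [exact: cGam|exact: ca'|exact: ca|exact: cG].
    by move=> y /a0 E; rewrite mulrfctE E mulr0.
  move=> E; have {E} <- :
      \int[mu]_y (flux c (v y) * a' y - G y * a y) +
      \int[mu]_y (Gam y * a' y + a y * G y) = 0.
    by rewrite E addr0; exact: weak_profile_eq sa da a0.
  rewrite -RintegralD//; first by apply: eq_Rintegral => y _; rewrite /G; ring.
  - apply: (@integrable_compact_support _ _ N) => [y|y yN].
      by apply: cvgB; apply: cvgM; [exact: cF|exact: ca'|exact: cG|exact: ca].
    by rewrite a'0// a0// !mulr0 subrr.
  - apply: (@integrable_compact_support _ _ N) => [y|y yN].
      by apply: cvgD; apply: cvgM; [exact: cGam|exact: ca'|exact: ca|exact: cG].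
    by rewrite a'0// a0// mulr0 mul0r addr0.
have -> : (fun y => flux c (v y)) = cst (flux c (v x) + Gam x) - Gam.
  by apply/funext => y; rewrite /cst !fctE (H x y) addrK.
by refine (is_derive_eq (is_deriveB (is_derive_cst _ x 1) (dGam x)) _);
  rewrite sub0r.
Qed.

End profile.
End Profile.

(** * The entropy functional *)

Section EntropyEquality.
Variable R : realType.
Implicit Types (f g F a b : R -> R) (x t : R) (phi psi : R * R -> R).
Let mu : measure _ R := @lebesgue_measure R.

(** Families of a single interval inside [[x - 1, x + 1]] suffice, whence the minimum with 1. *)
Lemma absolutely_continuous_continuous (v : R -> R) :
  (forall a b : R, absolutely_continuous_on a b v) -> continuous v.
Proof.
move=> acv x; apply/cvgrPdist_lt => e /(acv (x - 1) (x + 1))[d d0 H].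
have d1 : 0 < Num.min d 1 by rewrite lt_min d0 ltr01.
apply/nbhs_ballP; exists (Num.min d 1) => //= y.
rewrite /ball/= lt_min => /andP[yd y1].
have tr (z z' : R) : trivIset [set: 'I_1] (fun=> `]z, z'[%classic).
  by move=> i j _ _ _; rewrite !ord1.
move: yd y1; have [yx|xy] := leP y x; rewrite ltr_norml => yd /ltr_normlP[? ?].
- have := H 1%N (fun=> y) (fun=> x); rewrite !big_ord1; apply.
  + by move=> _; lra.
  + exact: tr.
  + by lra.
- have := H 1%N (fun=> x) (fun=> y); rewrite !big_ord1 distrC; apply.
  + by move=> _; lra.
  + exact: tr.
  + by move: yd; lra.
Qed.

Section test_function_facts.
Variables (phi : R * R -> R) (N : R).
Hypothesis tphi : test_function phi.
Hypothesis phi0 : forall x t, N < `|x| \/ N < `|t| -> phi (x, t) = 0.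

Lemma is_derive_partial_x (p : R * R) :
  is_derive p ((1, 0) : R * R) phi (partial_x phi p).
Proof. by have [/(_ 1%N)[_ dx _ _ _] _] := tphi; apply/derivableP. Qed.

Lemma is_derive_partial_t (p : R * R) :
  is_derive p ((0, 1) : R * R) phi (partial_t phi p).
Proof. by have [/(_ 1%N)[_ _ dt _ _] _] := tphi; apply/derivableP. Qed.

Lemma partial_x_eq0 x t : N < `|x| \/ N < `|t| -> partial_x phi (x, t) = 0.
Proof.
have d (y : R) : is_derive y 1 (fun y => phi (y, t)) (partial_x phi (y, t)).
  exact: (is_derive_fst phi (y, t) _).1 (is_derive_partial_x (y, t)).
case=> [xN|tN].
  by apply: (derive_eq0_outside d _ xN) => y yN; apply: phi0; left.
(* Here [phi] vanishes on the whole horizontal line; the bound -1 makes the condition on [y] hold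
   everywhere. *)
apply: (derive_eq0_outside (N := -1) d) => [y _|]; first by apply: phi0; right.
by rewrite (lt_le_trans _ (normr_ge0 x))// ltrN10.
Qed.

Lemma partial_t_eq0 x t : N < `|x| \/ N < `|t| -> partial_t phi (x, t) = 0.
Proof.
have d (y : R) : is_derive y 1 (fun y => phi (x, y)) (partial_t phi (x, y)).
  exact: (is_derive_snd phi (x, y) _).1 (is_derive_partial_t (x, y)).
case=> [xN|tN].
  apply: (derive_eq0_outside (N := -1) d) => [y _|]; first by apply: phi0; left.
  by rewrite (lt_le_trans _ (normr_ge0 t))// ltrN10.
by apply: (derive_eq0_outside d _ tN) => y yN; apply: phi0; right.
Qed.

End test_function_facts.

Lemma continuous_compact_support_bounded (E : R * R -> R) (N : R) :
  continuous E -> (forall x t, N < `|x| \/ N < `|t| -> E (x, t) = 0) ->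
  exists C, forall p, `|E p| <= C.
Proof.
move=> cE E0.
pose K := `[(- N), N]%classic `*` `[(- N), N]%classic : set (R * R).
have cK : compact K by apply: compact_setX; exact: segment_compact.
have /compact_bounded[C [_ HC]] : compact (E @` K).
  by apply: continuous_compact => //; exact: continuous_subspaceT.
exists (`|C| + 1) => -[x t].
have [xN|xN] := ltP N `|x|.
  by rewrite E0 ?normr0; [rewrite addr_ge0|left].
have [tN|tN] := ltP N `|t|.
  by rewrite E0 ?normr0; [rewrite addr_ge0|right].
apply: HC; first by rewrite (le_lt_trans (ler_norm C))// ltrDl.
by exists (x, t) => //; split => /=; rewrite in_itv/= -ler_norml.
Qed.

Section entropy.
Variables (c M : R) (v : R -> R).
Hypotheses (cv : continuous v) (vM : forall x, `|v x| <= M).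
Let G := convolution (@kernel_dK R) v.
Hypothesis dflux : forall x, is_derive x 1 (fun y => flux c (v y)) (- G x).
Variables (lambda N : R) (phi : R * R -> R).
Hypotheses (tphi : test_function phi) (N0 : 0 <= N).
Hypothesis phi0 : forall x t, N < `|x| \/ N < `|t| -> phi (x, t) = 0.

Let cG : continuous G. Proof. exact: continuous_convolution_dK. Qed.
Let w x := v x - lambda.
Let cw : continuous w.
Proof. by move=> x; apply: cvgB; [exact: cv|exact: cvg_cst]. Qed.

(** At [(x + c * t, t)] this is the derivative in [t] of [phi (x + c * t, t)]. *)
Let psi' (p : R * R) := c * partial_x phi p + partial_t phi p.
Let cphi : continuous phi. Proof. by have [/(_ 0%N)] := tphi. Qed.
Let cphix : continuous (partial_x phi).
Proof. by have [/(_ 1%N)[_ _ _ ? _] _] := tphi. Qed.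
Let cphit : continuous (partial_t phi).
Proof. by have [/(_ 1%N)[_ _ _ _ ?] _] := tphi. Qed.
Let cpsi' : continuous psi'.
Proof.
move=> p; apply: cvgD; last exact: cphit.
by apply: cvgM; [exact: cvg_cst|exact: cphix].
Qed.

Let psi'0 x t : N < `|x| \/ N < `|t| -> psi' (x, t) = 0.
Proof.
move=> xt; rewrite /psi' (partial_x_eq0 tphi phi0 xt) (partial_t_eq0 tphi phi0 xt).
by rewrite mulr0 addr0.
Qed.

Let cpair (f : R * R -> R) (p q : R -> R) : continuous f ->
  continuous p -> continuous q -> continuous (fun s => f (p s, q s)).
Proof.
move=> cf cp cq s; apply: (continuous_comp (f := fun s => (p s, q s))).
  exact: (cvg_pair (cp s) (cq s)).
exact: cf.
Qed.

Let ccst (k : R) : continuous (fun _ : R => k).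
Proof. by move=> x; exact: cvg_cst. Qed.
Let cid : continuous (fun x : R => x).
Proof. by move=> x; exact: cvg_id. Qed.
Let csh (k : R) : continuous (fun x : R => x + k).
Proof. by move=> x; apply: cvgD; [exact: cvg_id|exact: cvg_cst]. Qed.

(** One window in the moving variable that serves all times, since [|x| <= |x + c t| + |c| |t|]; a
    constant is then an integrable bound for [Q']. *)
Let L := N + `|c| * N.
Let Q t x := `|w x| * phi (x + c * t, t).
Let Q' t x := `|w x| * psi' (x + c * t, t).

Let moving_support (E : R * R -> R) t x :
  (forall x t, N < `|x| \/ N < `|t| -> E (x, t) = 0) ->
  L < `|x| -> E (x + c * t, t) = 0.
Proof.
move=> E0 Lx; apply: E0.
have [tN|tN] := ltP N `|t|; [by right|left].
have : `|x| <= `|x + c * t| + `|c| * `|t|.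
  by rewrite -normrM -{1}(addrK (c * t) x) ler_normB.
have : `|c| * `|t| <= `|c| * N by rewrite ler_wpM2l.
by move: Lx; rewrite /L; lra.
Qed.

Let cQ t : continuous (Q t).
Proof.
move=> x; apply: cvgM; first by apply: cvg_norm; exact: cw.
by apply: (cpair (p := fun x => x + c * t)).
Qed.

Let cQ' t : continuous (Q' t).
Proof.
move=> x; apply: cvgM; first by apply: cvg_norm; exact: cw.
by apply: (cpair (p := fun x => x + c * t)).
Qed.

Let inner t : \int[mu]_x
   (`|traveling_wave c v x t - lambda| * partial_t phi (x, t)
    + Num.sg (traveling_wave c v x t - lambda) *
      ((traveling_wave c v x t ^+ 2 - lambda ^+ 2) / 2) * partial_x phi (x, t)
    - Num.sg (traveling_wave c v x t - lambda) *
      convolution (@kernel_dK R) (traveling_wave c v ^~ t) x * phi (x, t)) =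
  \int[mu]_(x in `[(- L), L]) Q' t x.
Proof.
pose h x := flux c (v x) - flux c lambda.
pose p x := h (x - c * t) * phi (x, t).
pose p' x := h (x - c * t) * partial_x phi (x, t) + phi (x, t) * - G (x - c * t).
pose wt x := w (x - c * t).
have dh x : is_derive x 1 h (- G x).
  by refine (is_derive_eq (is_deriveB (dflux x) (is_derive_cst _ x 1)) _);
    rewrite subr0.
have ch := is_derive1_continuous dh.
have dp x : is_derive x 1 p (p' x).
  have := (is_derive_fst phi (x, t) _).1 (is_derive_partial_x tphi (x, t)).
  have := @is_derive1_affine _ h (- G (x - c * t)) 1 (- (c * t)) x.
  rewrite mul1r mulr1 => /(_ (dh _)) d1 d2.
  rewrite (_ : p = (fun y => h (1 * y - c * t)) * (fun y => phi (y, t))).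
    refine (is_derive_eq (is_deriveM d1 d2) _).
    by rewrite mul1r.
  by apply/funext => y; rewrite /p mulrfctE mul1r.
have cwt : continuous wt.
  move=> x; apply: (continuous_comp (f := fun x => x - c * t)); [exact: csh|exact: cw].
have cp' : continuous p'.
  move=> x; apply: cvgD; apply: cvgM.
  - apply: (continuous_comp (f := fun x => x - c * t)); [exact: csh|exact: ch].
  - exact: (@cpair _ (fun x => x) (fun=> t) cphix cid (@ccst t)).
  - exact: (@cpair _ (fun x => x) (fun=> t) cphi cid (@ccst t)).
  - apply: cvgN; apply: (continuous_comp (f := fun x => x - c * t)); [exact: csh|exact: cG].
have wp x : wt x = 0 -> p x = 0.
  rewrite /wt /w /p /h => /eqP; rewrite subr_eq0 => /eqP ->.
  by rewrite subrr mul0r.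
have p0 x : N < `|x| -> p x = 0 by move=> xN; rewrite /p phi0 ?mulr0//; left.
have sgn0 := Rintegral_sgr_derive cwt dp cp' wp p0.
have ip' := integrable_compact_support cp' (derive_eq0_outside dp p0).
have cE : continuous (fun x => `|wt x| * psi' (x, t)).
  move=> x; apply: cvgM; first by apply: cvg_norm; exact: cwt.
  exact: (@cpair _ (fun x => x) (fun=> t) cpsi' cid (@ccst t)).
(* In [h] the term [- c * (v - lambda)], multiplied by the sign, gives [- c |w|]; the part
   [c * partial_x phi] of [psi'] compensates it. *)
transitivity (\int[mu]_x (Num.sg (wt x) * p' x + `|wt x| * psi' (x, t))).
  apply: eq_Rintegral => x _; rewrite /traveling_wave convolution_shift.
  - rewrite -/(wt x) -/G /wt /w normrEsg /p' /h /flux /psi'; ring.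
  - exact: measurable_kernel_dK.
  - exact: continuous_measurable_fun.
rewrite RintegralD//; last 2 first.
- exact: integrable_sgrM.
- apply: (@integrable_compact_support _ _ N) => // x xN.
  by rewrite psi'0 ?mulr0//; left.
rewrite sgn0 add0r.
transitivity (\int[mu]_x Q' t (x - c * t)).
  by apply: eq_Rintegral => x _; rewrite /Q' subrK.
rewrite (@Rintegral_shift _ (Q' t)); last exact: continuous_measurable_fun.
apply: Rintegral_subset => // x _ /=; rewrite in_itv/= -ler_norml => /negP.
by rewrite -ltNge => Lx; rewrite /Q' moving_support ?mulr0.
Qed.

Let bounded_Q' : exists C, forall t x, `|Q' t x| <= C.
Proof.
have [C HC] := continuous_compact_support_bounded cpsi' psi'0.
exists ((M + `|lambda|) * C) => t x; rewrite /Q' normrM normr_id.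
apply: ler_pM => //; rewrite (le_trans (ler_normB _ _))// lerD2r//.
Qed.

(** In the moving frame the factor [|w x|] does not depend on [t], so the derivative falls on [phi]
    alone. *)
Let dQ t x : is_derive t 1 (Q ^~ x) (Q' t x).
Proof.
have := is_derive_along_line (x := x) (c := c) (t := t)
  (is_derive_partial_x tphi) cphix (is_derive_partial_t tphi _).
by move=> d; exact: is_deriveZ.
Qed.

Let J t := \int[mu]_(x in `[(- L), L]) Q t x.
Let J' t := \int[mu]_(x in `[(- L), L]) Q' t x.

Let dJ t : is_derive t 1 J (J' t).
Proof.
have [C HC] := bounded_Q'.
have C0 : 0 <= C by exact: le_trans (HC 0 0).
have It : `]t - 1, t + 1[%classic t by rewrite /= in_itv/=; lra.
have iQ (s : R) : `]t - 1, t + 1[%classic s ->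
    mu.-integrable `[(- L), L]%classic (EFin \o Q s).
  by move=> _; exact: continuous_integrable_itv.
have dQ1 (s x : R) : `]t - 1, t + 1[%classic s -> `[(- L), L]%classic x ->
    derivable (Q ^~ x) s 1.
  by move=> _ _; have [] := dQ s x.
have d1Q s x : partial1of2 Q s x = Q' s x.
  by rewrite partial1of2E; have [] := dQ s x.
have iC : mu.-integrable `[(- L), L]%classic (EFin \o (fun=> C)).
  exact: continuous_integrable_itv.
have bQ (s x : R) : `]t - 1, t + 1[%classic s -> `[(- L), L]%classic x ->
    `|partial1of2 Q s x| <= C.
  by rewrite d1Q.
(* [lebesgue_measure] lives on [measurableTypeR R], whose display is not the one
   of the measurable structure inferred for [R]. *)
have mB : @measurable _ (measurableTypeR R) `[(- L), L]%classic by [].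
apply: DeriveDef.
  exact: (derivable_under_integral mB It iQ dQ1 (fun=> C0) iC bQ).
rewrite -derive1E (differentiation_under_integral mB It iQ dQ1 (fun=> C0) iC bQ).
by apply: eq_Rintegral => x _; rewrite d1Q.
Qed.

Let cJ' : continuous J'.
Proof.
have [C HC] := bounded_Q'.
move=> t.
apply: (@continuity_under_integral _ _ _ mu Q' `[(- L), L]%classic _ (t - 1) (t + 1)
   _ _ (fun=> C)) => //.
- by move=> s _; exact: continuous_integrable_itv.
- apply: aeW => x _ s _; apply: cvgM; first exact: cvg_cst.
  apply: (cpair (p := fun s => x + c * s)) => // z.
  by apply: cvgD; [exact: cvg_cst|apply: cvgM; [exact: cvg_cst|exact: cvg_id]].
- exact: continuous_integrable_itv.
- by move=> s _; apply: aeW.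
- by rewrite inE/= in_itv/=; lra.
Qed.

(** The time integral of [J'] telescopes to [- J 0], and [J 0] is the initial term. *)
Lemma entropy_eq0 :
  \int[mu]_(t in `[0, +oo[) (\int[mu]_x
   (`|traveling_wave c v x t - lambda| * partial_t phi (x, t)
    + Num.sg (traveling_wave c v x t - lambda) *
      ((traveling_wave c v x t ^+ 2 - lambda ^+ 2) / 2) * partial_x phi (x, t)
    - Num.sg (traveling_wave c v x t - lambda) *
      convolution (@kernel_dK R) (traveling_wave c v ^~ t) x * phi (x, t)))
  + \int[mu]_x (`|v x - lambda| * phi (x, 0)) = 0.
Proof.
under eq_Rintegral do rewrite inner.
(* [phi] is known to vanish only for times strictly beyond [N]; at [N + 1] this gives
   [J (N + 1) = 0]. *)
have N1 : 0 <= N + 1 by rewrite addr_ge0.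
rewrite (@Rintegral_subset _ `[0, N + 1]%classic); last 2 first.
- by apply: subset_itvl; rewrite bnd_simp.
- move=> t /=; rewrite !in_itv/= andbT => t0; rewrite t0/= => /negP; rewrite -ltNge => Nt.
  rewrite (@Rintegral_subset _ set0) ?Rintegral_set0// => x _ _.
  rewrite /Q' psi'0 ?mulr0//; right; rewrite ger0_norm//; lra.
rewrite (Rintegral_derive N1 dJ cJ').
have -> : J (N + 1) = 0.
  rewrite /J (@Rintegral_subset _ set0) ?Rintegral_set0// => x _ _.
  by rewrite /Q phi0 ?mulr0//; right; rewrite ger0_norm//; lra.
apply/eqP; rewrite sub0r addrC subr_eq0; apply/eqP.
rewrite /J; transitivity (\int[mu]_x Q 0 x).
  by apply: eq_Rintegral => x _; rewrite /Q mulr0 addr0.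
apply: Rintegral_subset => // x _ /=; rewrite in_itv/= -ler_norml => /negP.
by rewrite -ltNge => Lx; rewrite /Q moving_support ?mulr0.
Qed.

End entropy.
End EntropyEquality.

Theorem proposition4p7 (R : realType) (c : R) (v : R -> R) :
  bounded_fun v ->
  absolutely_continuous v ->
  weak_solution v (traveling_wave c v) ->
  weak_entropy_solution v (traveling_wave c v).
Proof.
move=> [M0 [_ vM0]] [acv _] wv.
have cv := absolutely_continuous_continuous acv.
have vM x : `|v x| <= M0 + 1 by apply: vM0 => //; rewrite ltrDl.
have dflux := is_derive_flux cv vM wv.
split=> [|lambda phi tphi _]; first by case: wv.
have [N phi0] := test_function_support tphi.
(* The bound on the support may be negative if [phi] is zero, whereas [L] calls for a nonnegative
   one; hence [|N|]. *)
rewrite (@entropy_eq0 _ c (M0 + 1) v cv vM dflux lambda `|N| phi)// => x t xt.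
by apply: phi0; case: xt => xt; [left|right]; exact: le_lt_trans (ler_norm N) xt.
Qed.
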